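(* Let $k$ be a positive integer and consider the $k$-th order system of two rational difference equations $$x_n=\frac{\alpha+\sum^{k}_{i=1}\beta_{i}x_{n-i} + \sum^{k}_{i=1}\gamma_{i}y_{n-i}}{A+\sum^{k}_{j=1}B_{j}x_{n-j} + \sum^{k}_{j=1}C_{j}y_{n-j}},\qquad y_n=\frac{p+\sum^{k}_{i=1}\delta_{i}x_{n-i} + \sum^{k}_{i=1}\epsilon_{i}y_{n-i}}{q+\sum^{k}_{j=1}D_{j}x_{n-j} + \sum^{k}_{j=1}E_{j}y_{n-j}},\qquad n\in\mathbb{N},$$ with non-negative real parameters and non-negative initial conditions. Assume that there exist $M_1,M_3>0$ and $M_4\ge M_2\ge 0$ such that every solution satisfies $x_n\le M_1y_n+M_2\le M_3x_n+M_4$ for all $n\in\mathbb{N}$. Suppose that $q>0$ and that there exists a positive integer $\eta$ such that for every sequence $\{c_m\}_{m=1}^\infty$ with $c_m\in I_\delta\cup I_\epsilon$ for all $m\ge 1$ there exist positive integers $N_1,N_2\le\eta$ such that $\sum_{m=N_1}^{N_2}c_m\in I_D\cup I_E$. Then there exist $M>0$ and $N\in\mathbb{N}$ such that every solution (from any non-negative initial conditions) satisfies $x_n\le M$ and $y_n\le M$ for all $n>N$.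
   Context: $\mathbb{N}=\{1,2,\dots\}$. Initial conditions are $x_{1-k},\dots,x_0,y_{1-k},\dots,y_0\ge 0$; a solution is a pair of sequences generated by the system from non-negative initial conditions for which all denominators are positive for every $n\in\mathbb{N}$. Index sets in $\{1,\dots,k\}$: $I_\delta=\{i:\delta_i>0\}$, $I_\epsilon=\{i:\epsilon_i>0\}$, $I_D=\{j:D_j>0\}$, $I_E=\{j:E_j>0\}$. A sum $\sum_{m=N_1}^{N_2}$ with $N_1>N_2$ is empty and equals $0$. *)

(* Defs.v *)
From mathcomp Require Import all_boot all_order all_algebra.
From mathcomp Require Import reals.

Set Implicit Arguments.
Unset Strict Implicit.
Unset Printing Implicit Defensive.

Import Order.TTheory GRing.Theory Num.Theory.
Local Open Scope ring_scope.

(* The coefficient families are functions on [nat] of which only the values at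
   the indices 1, ..., k are ever used; the order k is kept outside the record. *)
Record params (R : realType) := Params {
  par_alpha : R; par_beta : nat -> R; par_gamma : nat -> R;
  par_A : R; par_B : nat -> R; par_C : nat -> R;
  par_p : R; par_delta : nat -> R; par_epsilon : nat -> R;
  par_q : R; par_D : nat -> R; par_E : nat -> R }.

Definition nonneg_params (R : realType) (k : nat) (P : params R) : Prop :=
  [/\ 0 <= par_alpha P, 0 <= par_A P, 0 <= par_p P & 0 <= par_q P] /\
  forall i : nat, (1 <= i <= k)%N ->
    [/\ 0 <= par_beta P i, 0 <= par_gamma P i, 0 <= par_B P i & 0 <= par_C P i] /\
    [/\ 0 <= par_delta P i, 0 <= par_epsilon P i, 0 <= par_D P i & 0 <= par_E P i].

Definition affine_form (R : realType) (k : nat) (a : R) (b c : nat -> R)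
    (x y : int -> R) (n : int) : R :=
  a + \sum_(1 <= i < k.+1) b i * x (n - i%:Z)
    + \sum_(1 <= i < k.+1) c i * y (n - i%:Z).

Definition x_num (R : realType) (k : nat) (P : params R) :=
  affine_form k (par_alpha P) (par_beta P) (par_gamma P).
Definition x_den (R : realType) (k : nat) (P : params R) :=
  affine_form k (par_A P) (par_B P) (par_C P).
Definition y_num (R : realType) (k : nat) (P : params R) :=
  affine_form k (par_p P) (par_delta P) (par_epsilon P).
Definition y_den (R : realType) (k : nat) (P : params R) :=
  affine_form k (par_q P) (par_D P) (par_E P).

(* Sequences are indexed by [int] so that x_{1-k}, ..., x_0 can be written as
   such; the values at indices below 1-k are unconstrained and never used. *)
Definition is_solution (R : realType) (k : nat) (P : params R)
    (x y : int -> R) : Prop :=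
  (forall i : int, 1 - k%:Z <= i <= 0 -> 0 <= x i /\ 0 <= y i) /\
  (forall n : nat, (1 <= n)%N ->
    [/\ 0 < x_den k P x y n%:Z,
        0 < y_den k P x y n%:Z,
        x n%:Z = x_num k P x y n%:Z / x_den k P x y n%:Z &
        y n%:Z = y_num k P x y n%:Z / y_den k P x y n%:Z]).

Definition pos_indices (R : realType) (k : nat) (a : nat -> R) : pred nat :=
  [pred i : nat | (1 <= i <= k)%N && (0 < a i)].

(* Main.v *)
Require Import Defs.
From mathcomp Require Import all_boot all_order all_algebra.
From mathcomp Require Import reals.
From mathcomp Require Import zify ring lra.

(* Put w_n = 1 + y_n.  Since x and y are comparable, w_n <= K w_{n-i} for the
   index i in I_delta \cup I_epsilon which maximises w_{n-i}, and moreover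
   y_n w_{n-j} <= K w_{n-i} for every j in I_D \cup I_E.  Following the
   maximising indices backwards from n yields n = n_0 > n_1 > ... with steps
   c_1, c_2, ...; the chain hypothesis gives a < b <= eta such that
   n_a - n_b = j lies in I_D \cup I_E.  As w_{n_{a+1}} <= K^(b-a-1) w_{n_b},
   the factor w_{n_b} cancels from y_{n_a} w_{n_b} <= K w_{n_{a+1}}, so y_{n_a},
   and hence w_n, is bounded by a constant depending on K and eta only. *)

Import Order.TTheory GRing.Theory Num.Theory.
Local Open Scope ring_scope.

(** * Backward chains of indices, and the bound they give for an abstract sequence *)

Definition descent (s : nat -> nat) n m := iter m (fun t => (t - s t)%N) n.

Section Descent.
Variables (k : nat) (s : nat -> nat).
Hypothesis s_le : forall t, (s t <= k)%N.

Local Notation pos := (descent s).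

Lemma descentS n m : pos n m.+1 = (pos n m - s (pos n m))%N.
Proof. by []. Qed.

Lemma descent_lower n m : (n <= pos n m + k * m)%N.
Proof.
elim: m => [|m IH]; first by rewrite muln0 addn0.
by have := s_le (pos n m); move: IH; rewrite descentS mulnS; lia.
Qed.

(** Each step is at most [k], so starting above [k * eta.+1] leaves more than [k] after [eta] steps.
    Hence the natural subtraction in [descent] never truncates along the chain, and the recursion
    applies at every index visited. *)
Lemma descent_gt eta n m : (k * eta.+1 < n)%N -> (m <= eta)%N -> (k < pos n m)%N.
Proof.
move=> n_gt m_le; have := descent_lower n m.
have := leq_mul (leqnn k) m_le; rewrite mulnS in n_gt; lia.
Qed.

Lemma descent_sum eta n a b : (k * eta.+1 < n)%N -> (a <= b <= eta)%N ->
  (pos n b + \sum_(a <= m < b) s (pos n m) = pos n a)%N.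
Proof.
move=> n_gt /andP[]; elim: b => [|b IH].
  by rewrite leqn0 => /eqP-> _; rewrite big_geq ?addn0.
rewrite leq_eqVlt => /orP[/eqP-> _|]; first by rewrite big_geq ?addn0.
rewrite ltnS => le_ab lt_b; rewrite descentS big_nat_recr //=.
rewrite -(IH le_ab (ltnW lt_b)).
have := descent_gt _ _ _ n_gt (ltnW lt_b); have := s_le (pos n b).
by move: (\sum_(_ <= _ < _) _)%N; lia.
Qed.

Lemma descent_growth (R : realType) (w : nat -> R) (K : R) eta n a b : 1 <= K ->
  (forall t, (k < t)%N -> w t <= K * w (t - s t)%N) ->
  (k * eta.+1 < n)%N -> (a <= b <= eta)%N ->
  w (pos n a) <= K ^+ (b - a) * w (pos n b).
Proof.
move=> K_ge1 w_step n_gt /andP[]; elim: b => [|b IH].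
  by rewrite leqn0 => /eqP-> _; rewrite expr0 mul1r.
rewrite leq_eqVlt => /orP[/eqP-> _|]; first by rewrite subnn expr0 mul1r.
rewrite ltnS => le_ab lt_b; apply: le_trans (IH le_ab (ltnW lt_b)) _.
have K_ge0 : 0 <= K := le_trans ler01 K_ge1.
rewrite subSn // exprSr -mulrA ler_wpM2l ?exprn_ge0 //.
exact: w_step (descent_gt _ _ _ n_gt (ltnW lt_b)).
Qed.

End Descent.

(** The argument isolated from the system: [w] stands for 1 + y, [I] for the numerator indices and
    [J] for the denominator indices. Quantifying over every bound [W] instead of naming the maximum
    also covers an empty [I]. *)
Lemma chain_bound (R : realType) (k eta : nat) (w : nat -> R) (K : R)
    (I J : pred nat) :
  (0 < eta)%N -> 1 <= K ->
  (forall i, i \in I -> (i <= k)%N) ->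
  (forall t, (0 < t)%N -> 1 <= w t) ->
  (forall t W, (k < t)%N -> 1 <= W -> (forall i, i \in I -> w (t - i)%N <= W) ->
     w t <= K * W /\ forall j, j \in J -> (w t - 1) * w (t - j)%N <= K * W) ->
  (forall c : nat -> nat, (forall m, (1 <= m)%N -> c m \in I) ->
     exists N1 N2 : nat, [/\ (1 <= N1 <= eta)%N, (1 <= N2 <= eta)%N &
       (\sum_(N1 <= m < N2.+1) c m)%N \in J]) ->
  (forall j, j \in J -> (0 < j)%N) ->
  forall n, (k * eta.+1 < n)%N -> w n <= 2 * K ^+ eta.
Proof.
move=> eta_gt0 K_ge1 I_le w_ge1 w_rec chain J_gt0 n n_gt.
have K_ge0 : 0 <= K := le_trans ler01 K_ge1.
have Kexp_ge1 m : 1 <= K ^+ m by exact: exprn_ege1.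
have n_gtk : (k < n)%N by rewrite mulnS in n_gt; lia.
(* If [I] is empty, then [W = 1] is vacuously admissible and already gives [w n <= K]. *)
have [i0 Ii0|I0] := pickP (fun i : 'I_k.+1 => (i : nat) \in I); last first.
  have [||w_le _] := w_rec n 1 n_gtk; rewrite ?lexx //.
    by move=> i Ii; have := I0 (Ordinal (I_le i Ii : (i < k.+1)%N)); rewrite Ii.
  have : K ^+ 1 <= K ^+ eta by rewrite ler_weXn2l.
  by have := Kexp_ge1 eta; lra.
pose s t : nat := [arg max_(i > i0 | (i : nat) \in I) w (t - i)%N]%O.
have sI t : s t \in I by rewrite /s; case: arg_maxP.
have s_max t i : i \in I -> w (t - i)%N <= w (t - s t)%N.
  move=> Ii; rewrite /s; case: arg_maxP => // m _.
  by move/(_ (Ordinal (I_le i Ii : (i < k.+1)%N)) Ii).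
have s_le t : (s t <= k)%N by exact: I_le.
have s_rec t (t_gt : (k < t)%N) :
    w t <= K * w (t - s t)%N /\
    forall j, j \in J -> (w t - 1) * w (t - j)%N <= K * w (t - s t)%N.
  apply: w_rec => //; last exact: s_max.
  by apply: w_ge1; have := s_le t; lia.
have w_step t t_gt := (s_rec t t_gt).1.
pose pos := descent s n.
have [N1 [N2 [/andP[N1_gt0 N1_le] /andP[_ N2_le] J_sum]]] :=
  chain (fun m => s (pos m.-1)) (fun m _ => sI _).
(* Otherwise the sum is empty and equals 0, which is not in [J]. *)
have lt_N : (N1.-1 < N2)%N.
  rewrite ltnNge; apply/negP => leN.
  by move: (J_gt0 _ J_sum); rewrite big_geq //; lia.
have sumE := descent_sum k s s_le eta n N1.-1 N2 n_gt.
rewrite -{1}(prednK N1_gt0) big_add1 /= in J_sum.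
have pos_b : (pos N1.-1 - \sum_(N1.-1 <= m < N2) s (pos m))%N = pos N2.
  by rewrite -[X in (X - _)%N]sumE ?addnK //; apply/andP; split=> //; exact: ltnW.
have gt_a : (k < pos N1.-1)%N by apply: (descent_gt _ _ s_le) n_gt _; lia.
have gt_b : (k < pos N2)%N by apply: (descent_gt _ _ s_le) n_gt _.
have wb_ge1 := w_ge1 _ (leq_ltn_trans (leq0n k) gt_b).
have := (s_rec _ gt_a).2 _ J_sum; rewrite pos_b => rec_a.
have grow_b := descent_growth k s s_le R w K eta n N1 N2 K_ge1 w_step n_gt.
have grow_a := descent_growth k s s_le R w K eta n 0 N1.-1 K_ge1 w_step n_gt.
move: grow_a; rewrite -/(pos _) subn0 /= => /(_ ltac:(lia)) grow_a.
move: grow_b; rewrite -!/(pos _) => /(_ ltac:(lia)) grow_b.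
have posS : (pos N1.-1 - s (pos N1.-1))%N = pos N1.
  by rewrite -[in RHS](prednK N1_gt0).
rewrite posS in rec_a.
(* Both sides are multiplied by [w (pos N2)], which is positive: [rec_a] bounds the left by
   [K * w (pos N1)], and [grow_b] brings this back to [w (pos N2)]. *)
have y_le : w (pos N1.-1) - 1 <= K ^+ (N2 - N1).+1.
  rewrite -(ler_pM2r (lt_le_trans ltr01 wb_ge1)) exprS -mulrA.
  by apply: le_trans rec_a _; rewrite ler_wpM2l.
apply: le_trans grow_a _.
(* The 2 absorbs the 1 in w = 1 + (w - 1), and the exponents add up to [N2 <= eta]. *)
apply: (@le_trans _ _ (K ^+ N1.-1 * (2 * K ^+ (N2 - N1).+1))).
  rewrite ler_wpM2l ?exprn_ge0 //.
  by have := Kexp_ge1 (N2 - N1).+1; lra.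
rewrite mulrCA -exprD ler_wpM2l // ler_weXn2l //; lia.
Qed.

(** * Affine forms beyond the initial indices, and non-negativity of solutions *)

Lemma affine_form_nat (R : realType) k a (b c : nat -> R) x y n : (k < n)%N ->
  affine_form k a b c x y n%:Z =
  a + \sum_(1 <= i < k.+1) b i * x (n - i)%N%:Z
    + \sum_(1 <= i < k.+1) c i * y (n - i)%N%:Z.
Proof.
move=> k_lt; rewrite /affine_form; congr (_ + _ + _);
by apply: eq_big_nat => i i_in; rewrite subzn //; lia.
Qed.

Lemma sum_nat_ge_term (R : realType) k (F : nat -> R) j :
  (forall i, (1 <= i <= k)%N -> 0 <= F i) -> (1 <= j <= k)%N ->
  F j <= \sum_(1 <= i < k.+1) F i.
Proof.
move=> F_ge0 j_in.
rewrite (big_rem j) ?mem_index_iota //= lerDl big_seq sumr_ge0 // => i.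
by move/mem_rem; rewrite mem_index_iota => /F_ge0.
Qed.

Lemma sum_nat_ge0 (R : realType) k (F : nat -> R) :
  (forall i, (1 <= i <= k)%N -> 0 <= F i) -> 0 <= \sum_(1 <= i < k.+1) F i.
Proof.
by move=> F_ge0; rewrite big_nat sumr_ge0 // => i /F_ge0.
Qed.

Lemma solution_ge0 (R : realType) k (P : params R) x y : (0 < k)%N ->
  nonneg_params k P -> is_solution k P x y ->
  forall n : nat, 0 <= x n%:Z /\ 0 <= y n%:Z.
Proof.
move=> k_gt0 [[al_ge0 _ p_ge0 _] P_ge0] [init sol].
elim/ltn_ind => n IH; case: (posnP n) => [->|n_gt0]; first by apply: init; lia.
have prev i : (1 <= i <= k)%N -> 0 <= x (n%:Z - i%:Z) /\ 0 <= y (n%:Z - i%:Z).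
  move=> i_in; have [le_in|lt_ni] := leqP i n; last by apply: init; lia.
  by rewrite subzn //; apply: IH; lia.
have [xd_gt0 yd_gt0 -> ->] := sol n n_gt0.
by split; rewrite divr_ge0 ?(ltW xd_gt0) ?(ltW yd_gt0) // !addr_ge0 //
    sum_nat_ge0 // => i i_in;
  have [[? ? ? ?] [? ? ? ?]] := P_ge0 i i_in; have [? ?] := prev i i_in;
  rewrite mulr_ge0.
Qed.

(** * One-step estimates for 1 + y along a fixed solution *)

Section Estimates.
Variables (R : realType) (k : nat) (P : params R) (M1 M2 M3 M4 : R).
Hypotheses (k_gt0 : (0 < k)%N) (P_ge0 : nonneg_params k P).
Hypothesis q_gt0 : 0 < par_q P.
Hypotheses (M1_gt0 : 0 < M1) (M3_gt0 : 0 < M3) (M2_ge0 : 0 <= M2) (M2_le : M2 <= M4).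
Variables x y : int -> R.
Hypothesis sol : is_solution k P x y.
Hypothesis comparable_xy : forall n : nat, (1 <= n)%N ->
  x n%:Z <= M1 * y n%:Z + M2 /\ M1 * y n%:Z + M2 <= M3 * x n%:Z + M4.

(** If 1 + y <= W and W >= 1, then x <= M1 y + M2 <= (M1 + M2) W; this is the weight given to the
    [par_delta] terms. *)
Definition num_const : R := par_p P
  + \sum_(1 <= i < k.+1) par_delta P i * (M1 + M2)
  + \sum_(1 <= i < k.+1) par_epsilon P i.

(* Indices with a zero coefficient contribute 0 to the sum, as 0^-1 = 0. *)
Definition den_const : R := (1 + M4 / M1) / par_q P
  + \sum_(1 <= j < k.+1) (M3 / M1 * (par_D P j)^-1 + (par_E P j)^-1).

Lemma num_const_ge0 : 0 <= num_const.
Proof.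
case: P_ge0 => [[_ _ p_ge0 _] c_ge0].
rewrite /num_const !addr_ge0 //; apply: sum_nat_ge0 => i /c_ge0[_ [? ? _ _]] //.
by rewrite mulr_ge0 // addr_ge0 // ltW.
Qed.

Lemma den_term_ge0 j : (1 <= j <= k)%N ->
  0 <= M3 / M1 * (par_D P j)^-1 + (par_E P j)^-1.
Proof.
case: P_ge0 => _ c_ge0 /c_ge0[_ [_ _ ? ?]].
by rewrite addr_ge0 ?mulr_ge0 ?invr_ge0 // ltW.
Qed.

Lemma den_const_ge0 : 0 <= den_const.
Proof.
rewrite addr_ge0 ?sum_nat_ge0 //; last exact: den_term_ge0.
have M4_ge0 := le_trans M2_ge0 M2_le.
by apply: divr_ge0; [apply: addr_ge0; rewrite ?divr_ge0 // ltW | exact: ltW].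
Qed.

Lemma y_num_le t W : (k < t)%N -> 1 <= W ->
  (forall i, i \in [predU pos_indices k (par_delta P) & pos_indices k (par_epsilon P)] ->
     1 + y (t - i)%N%:Z <= W) ->
  y_num k P x y t%:Z <= num_const * W.
Proof.
move=> t_gt W_ge1 W_ge; rewrite /y_num affine_form_nat //.
case: P_ge0 => [[_ _ p_ge0 _] c_ge0].
rewrite /num_const !mulrDl !mulr_suml !lerD //; first by rewrite ler_peMr.
  rewrite !big_nat ler_sum // => i i_in.
  have [_ [d_ge0 _ _ _]] := c_ge0 i i_in.
  (* The bound [W] says nothing about an index outside the index set, but there the coefficient
     vanishes. *)
  move: d_ge0; rewrite le_eqVlt => /orP[/eqP<-|d_gt0]; first by rewrite !mul0r.
  rewrite -mulrA ler_pM2l //.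
  have := W_ge i; rewrite !inE d_gt0; have -> /= : (1 <= i <= k)%N by [].
  move=> /(_ isT) y_le; have [|x_le _] := comparable_xy (t - i); first lia.
  have : M1 * (1 + y (t - i)%N%:Z) <= M1 * W by rewrite ler_pM2l.
  have : M2 * 1 <= M2 * W by rewrite ler_wpM2l.
  by have := M1_gt0; rewrite mulrDr mulrDl; lra.
rewrite !big_nat ler_sum // => i i_in.
have [_ [_ e_ge0 _ _]] := c_ge0 i i_in.
move: e_ge0; rewrite le_eqVlt => /orP[/eqP<-|e_gt0]; first by rewrite !mul0r.
rewrite ler_pM2l //.
have := W_ge i; rewrite !inE e_gt0; have -> /= : (1 <= i <= k)%N by [].
by rewrite orbT => /(_ isT); lra.
Qed.

Lemma y_den_terms t : (k < t)%N ->
  par_q P <= y_den k P x y t%:Z /\ forall j, (1 <= j <= k)%N ->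
    par_D P j * x (t - j)%N%:Z <= y_den k P x y t%:Z /\
    par_E P j * y (t - j)%N%:Z <= y_den k P x y t%:Z.
Proof.
move=> t_gt; rewrite /y_den affine_form_nat //.
case: P_ge0 => _ c_ge0.
have xy_ge0 := solution_ge0 _ k P x y k_gt0 P_ge0 sol.
have Dx_ge0 j : (1 <= j <= k)%N -> 0 <= par_D P j * x (t - j)%N%:Z.
  by move=> /c_ge0[_ [_ _ ? _]]; rewrite mulr_ge0 // (xy_ge0 _).1.
have Ey_ge0 j : (1 <= j <= k)%N -> 0 <= par_E P j * y (t - j)%N%:Z.
  by move=> /c_ge0[_ [_ _ _ ?]]; rewrite mulr_ge0 // (xy_ge0 _).2.
have D_ge0 := sum_nat_ge0 _ _ _ Dx_ge0.
have E_ge0 := sum_nat_ge0 _ _ _ Ey_ge0.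
split=> [|j j_in]; first by lra.
have := sum_nat_ge_term _ _ _ _ Dx_ge0 j_in.
have := sum_nat_ge_term _ _ _ _ Ey_ge0 j_in.
by have := q_gt0; lra.
Qed.

(** A positive [par_E P j] bounds y at [t - j] by a multiple of the denominator. A positive
    [par_D P j] does so for x, and the second comparison turns this into a bound for y. The additive
    constants are absorbed because the denominator is at least [par_q P]. *)
Lemma y_den_ge t j : (k < t)%N ->
  j \in [predU pos_indices k (par_D P) & pos_indices k (par_E P)] ->
  1 + y (t - j)%N%:Z <= den_const * y_den k P x y t%:Z.
Proof.
move=> t_gt J_j; have [q_le den_ge] := y_den_terms t t_gt.
have j_in : (1 <= j <= k)%N by move: J_j; rewrite !inE => /orP[] /andP[].
have [Dx_le Ey_le] := den_ge j j_in.
set d := y_den _ _ _ _ _ in q_le Dx_le Ey_le *.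
have d_gt0 : 0 < d := lt_le_trans q_gt0 q_le.
have [|_ y_le] := comparable_xy (t - j)%N; first by lia.
have [x_ge0 y_ge0] := solution_ge0 _ k P x y k_gt0 P_ge0 sol (t - j)%N.
have [_ [_ _ D_ge0 E_ge0]] := P_ge0.2 j j_in.
have term_le := sum_nat_ge_term _ _ _ _ den_term_ge0 j_in.
have M41_ge0 : 0 <= M4 / M1 := divr_ge0 (le_trans M2_ge0 M2_le) (ltW M1_gt0).
have M31_ge0 : 0 <= M3 / M1 := divr_ge0 (ltW M3_gt0) (ltW M1_gt0).
have const_le : 1 + M4 / M1 <= (1 + M4 / M1) / par_q P * d.
  rewrite -mulrA ler_peMr //; first by lra.
  by rewrite mulrC ler_pdivlMr // mul1r.
(* [den_const] is bounded below by its constant part plus its [j]-th summand. *)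
apply: (@le_trans _ _ ((1 + M4 / M1) / par_q P * d
    + (M3 / M1 * (par_D P j)^-1 + (par_E P j)^-1) * d)); last first.
  by rewrite -mulrDl ler_pM2r // lerD2l.
rewrite mulrDl.
have D_le : 0 <= M3 / M1 * (par_D P j)^-1 * d.
  by rewrite !mulr_ge0 ?invr_ge0 // ltW.
have E_le : 0 <= (par_E P j)^-1 * d by rewrite mulr_ge0 ?invr_ge0 // ltW.
move: J_j; rewrite !inE j_in /= => /orP[D_gt0|E_gt0]; last first.
  have : y (t - j)%N%:Z <= (par_E P j)^-1 * d by rewrite mulrC ler_pdivlMr // mulrC.
  by lra.
have x_le : x (t - j)%N%:Z <= (par_D P j)^-1 * d by rewrite mulrC ler_pdivlMr // mulrC.
have {}y_le : y (t - j)%N%:Z <= M3 / M1 * x (t - j)%N%:Z + M4 / M1.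
  by have := M2_ge0; rewrite mulrAC -mulrDl ler_pdivlMr // mulrC; lra.
have := ler_wpM2l M31_ge0 x_le; rewrite mulrA; lra.
Qed.

(** The first two terms bound 1 + y_t, using that the denominator is at least [par_q P]; the last
    one bounds the product in [y_step]. *)
Definition step_const : R := 1 + num_const / par_q P + den_const * num_const.

Lemma step_const_ge1 : 1 <= step_const.
Proof.
have a_ge0 := num_const_ge0; have L_ge0 := den_const_ge0.
rewrite /step_const -addrA lerDl addr_ge0 ?divr_ge0 ?mulr_ge0 // ltW //.
Qed.

Lemma y_step t W : (k < t)%N -> 1 <= W ->
  (forall i, i \in [predU pos_indices k (par_delta P) & pos_indices k (par_epsilon P)] ->
     1 + y (t - i)%N%:Z <= W) ->
  1 + y t%:Z <= step_const * W /\
  forall j, j \in [predU pos_indices k (par_D P) & pos_indices k (par_E P)] ->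
    (1 + y t%:Z - 1) * (1 + y (t - j)%N%:Z) <= step_const * W.
Proof.
move=> t_gt W_ge1 W_ge; have num_le := y_num_le t W t_gt W_ge1 W_ge.
have a_ge0 := num_const_ge0; have L_ge0 := den_const_ge0.
have [q_le _] := y_den_terms t t_gt.
have t_gt0 : (0 < t)%N by lia.
have [_ d_gt0 _ yE] := sol.2 t t_gt0.
have y_ge0 := (solution_ge0 _ k P x y k_gt0 P_ge0 sol t).2.
have yd : y t%:Z * y_den k P x y t%:Z = y_num k P x y t%:Z.
  by rewrite yE mulfVK // gt_eqF.
have W_ge0 : 0 <= W by lra.
have aq_ge0 : 0 <= num_const / par_q P * W by rewrite !mulr_ge0 ?invr_ge0 // ltW.
have La_ge0 : 0 <= den_const * num_const * W by rewrite !mulr_ge0.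
have stepE : step_const * W =
    W + num_const / par_q P * W + den_const * num_const * W.
  by rewrite /step_const; ring.
rewrite stepE; split=> [|j J_j].
  have : y t%:Z <= num_const / par_q P * W.
    rewrite mulrAC ler_pdivlMr //; apply: le_trans num_le.
    by rewrite -yd ler_wpM2l.
  by lra.
(* Multiplying [y_den_ge] by y_t turns the denominator into the numerator, which [num_le] bounds. *)
have := ler_wpM2l y_ge0 (y_den_ge t j t_gt J_j).
have := ler_wpM2l L_ge0 num_le.
by rewrite -yd; lra.
Qed.

End Estimates.

(** * Assembly of the uniform bound *)

Theorem theorem21 (R : realType) (k : nat) (P : params R)
  (k_gt0 : (0 < k)%N)
  (P_ge0 : nonneg_params k P)
  (comparable_xy : exists M1 M2 M3 M4 : R,
     [/\ 0 < M1, 0 < M3, 0 <= M2 & M2 <= M4] /\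
     forall x y : int -> R, is_solution k P x y ->
       forall n : nat, (1 <= n)%N ->
         x n%:Z <= M1 * y n%:Z + M2 /\
         M1 * y n%:Z + M2 <= M3 * x n%:Z + M4)
  (q_gt0 : 0 < par_q P)
  (chain : exists eta : nat, (0 < eta)%N /\
     forall c : nat -> nat,
       (forall m : nat, (1 <= m)%N ->
          c m \in [predU pos_indices k (par_delta P) & pos_indices k (par_epsilon P)]) ->
       exists N1 N2 : nat,
         [/\ (1 <= N1 <= eta)%N, (1 <= N2 <= eta)%N &
             (\sum_(N1 <= m < N2.+1) c m)%N
               \in [predU pos_indices k (par_D P) & pos_indices k (par_E P)]]) :
  exists (M : R) (N : nat), [/\ 0 < M, (1 <= N)%N &
    forall x y : int -> R, is_solution k P x y ->
      forall n : nat, (N < n)%N -> x n%:Z <= M /\ y n%:Z <= M].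
Proof.
have [M1 [M2 [M3 [M4 [[M1_gt0 M3_gt0 M2_ge0 M2_le] xy_le]]]]] := comparable_xy.
have [eta [eta_gt0 chainP]] := chain.
pose K := step_const R k P M1 M2 M3 M4.
have K_ge1 : 1 <= K by exact: step_const_ge1.
pose Y : R := 2 * K ^+ eta.
have Y_ge2 : 2 <= Y by have := exprn_ege1 eta K_ge1; rewrite /Y; lra.
have M1Y_ge0 : 0 <= M1 * Y by rewrite mulr_ge0 ?ltW //; lra.
(* [Y] bounds y and [M1 * Y + M2] bounds x, so their sum serves both; the threshold is the room that
   [eta] backward steps require. *)
exists (Y + (M1 * Y + M2)), (k * eta.+1)%N; split; [by lra | by rewrite muln_gt0 k_gt0 |].
move=> x y sol n n_gt.
have y_le : 1 + y n%:Z <= Y.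
  apply: (chain_bound R k eta (fun t => 1 + y t%:Z) K) eta_gt0 K_ge1 _ _ _ chainP _ n n_gt.
  - by move=> i; rewrite !inE => /orP[] /andP[/andP[]].
  - by move=> t _; rewrite lerDl (solution_ge0 _ k P x y k_gt0 P_ge0 sol t).2.
  - exact: (y_step R k P M1 M2 M3 M4 k_gt0 P_ge0 q_gt0 M1_gt0 M3_gt0 M2_ge0
      M2_le x y sol (xy_le x y sol)).
  - by move=> j; rewrite !inE => /orP[] /andP[/andP[]].
have [|x_le _] := xy_le x y sol n; first by lia.
have : M1 * y n%:Z <= M1 * Y by rewrite ler_pM2l //; lra.
by split; lra.
Qed.
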